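(* Let $(N^{(1)},N^{(2)},N^{(3)})\in\tilde{\mathcal R}_1$. Then the set-valued map $\mathrm{Right}\,S$ from $\tilde{\mathcal R}_1$ to $\mathcal S_3(\mathbb C,\mathbb C)$ is well defined and $$\mathrm{Right}\,S(N^{(1)},N^{(2)},N^{(3)})=\{\eta f:\eta\in\mathbb T\},$$ where $f:\mathbb D^3\to\mathbb C$ is analytic and satisfies $$K_{(N^{(1)},N^{(2)},N^{(3)})}(\lambda,\mathbf z,\mu,\mathbf w)=\overline{f(\mathbf w,\mu)}f(\mathbf z,\lambda)$$ for all $\lambda,\mu\in\mathbb D$ and $\mathbf z,\mathbf w\in\mathbb D^2$.
   Context: $\mathbb D$ is the open unit disc and $\mathbb T$ the unit circle. $\mathcal S_3(\mathbb C,\mathbb C)$ is the Schur class of the tridisc, i.e. the set of analytic functions $f$ on $\mathbb D^3$ with $|f|\le1$. An analytic kernel on $\mathbb D^3$ is a positive semidefinite function $N(\lambda,\mathbf z,\mu,\mathbf w)$ of $(\lambda,\mathbf z),(\mu,\mathbf w)\in\mathbb D\times\mathbb D^2=\mathbb D^3$, analytic in $(\lambda,\mathbf z)$ and conjugate-analytic in $(\mu,\mathbf w)$; its rank is the dimension of its reproducing kernel Hilbert space. With $\mathbf z=(z_1,z_2)$, $\mathbf w=(w_1,w_2)$, put $$K_{(N^{(1)},N^{(2)},N^{(3)})}=1-(1-\bar w_1z_1)N^{(1)}-(1-\bar w_2z_2)N^{(2)}-(1-\bar\mu\lambda)N^{(3)},$$ all functions being evaluated at $(\lambda,\mathbf z,\mu,\mathbf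 w)$. $\tilde{\mathcal R}_1$ is the set of triples $(N^{(1)},N^{(2)},N^{(3)})$ such that $N^{(1)},N^{(2)},N^{(3)}$ and $K_{(N^{(1)},N^{(2)},N^{(3)})}$ are analytic kernels on $\mathbb D^3$ and $K_{(N^{(1)},N^{(2)},N^{(3)})}$ is of rank 1. For $(N^{(1)},N^{(2)},N^{(3)})\in\tilde{\mathcal R}_1$, $\mathrm{Right}\,S(N^{(1)},N^{(2)},N^{(3)})$ is the set of all $f\in\mathcal S_3(\mathbb C,\mathbb C)$ with $K_{(N^{(1)},N^{(2)},N^{(3)})}(\lambda,\mathbf z,\mu,\mathbf w)=\overline{f(\mathbf w,\mu)}f(\mathbf z,\lambda)$ for all $\mathbf z,\mathbf w\in\mathbb D^2$, $\lambda,\mu\in\mathbb D$; well-definedness means that this set is a nonempty subset of $\mathcal S_3(\mathbb C,\mathbb C)$. *)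

(* Defs.v *)
From HB Require Import structures.
From mathcomp Require Import all_boot all_order all_algebra.
From mathcomp Require Import complex.
From mathcomp Require Import all_classical all_reals all_analysis.

Set Implicit Arguments.
Unset Strict Implicit.
Unset Printing Implicit Defensive.

Import Order.TTheory GRing.Theory Num.Theory.
Import numFieldNormedType.Exports.

Local Open Scope classical_set_scope.
Local Open Scope ring_scope.

(* [R[i]] viewed through its [numClosedFieldType] structure, so that the
   normed-space structures of MathComp-Analysis on numeric fields apply. *)
Definition Cplx (R : realType) : numClosedFieldType := R[i].

(* The order of [Cplx R] is partial: [0 <= z] says that [z] is real and
   nonnegative. *)
Definition disc (R : realType) := {z : Cplx R | `|z| < 1}.

Definition bidisc (R : realType) := (disc R * disc R)%type.

Definition unit_circle (R : realType) : set (Cplx R) := [set z | `|z| = 1].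

(* Analyticity is complex Frechet differentiability at every point of the
   tridisc. [differentiable] needs a function on the whole of C^3, so we ask
   for some [G] on C^3 that restricts to [g]; its values off the (open)
   tridisc are irrelevant. *)
Definition analytic3 (R : realType) (g : disc R -> disc R -> disc R -> Cplx R) :=
  exists G : Cplx R * (Cplx R * Cplx R) -> Cplx R,
    (forall a b c, G (val a, (val b, val c)) = g a b c) /\
    (forall a b c : disc R, differentiable G (val a, (val b, val c))).

Section ReproducingKernel.
Variables (R : realType) (X : Type).

Definition psd (N : X -> X -> Cplx R) :=
  forall (n : nat) (x : 'I_n -> X) (c : 'I_n -> Cplx R),
    0 <= \sum_(i < n) \sum_(j < n) (c i)^* * c j * N (x i) (x j).

(* [(H, ip)] is the reproducing kernel Hilbert space of [N]: a space of
   functions on [X], with an inner product linear in its first argument;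
   [fun x => N x y] is the kernel function at [y]. Only the values of [ip] on
   [H] matter. *)
Record is_rkhs (N : X -> X -> Cplx R) (H : set (X -> Cplx R))
    (ip : (X -> Cplx R) -> (X -> Cplx R) -> Cplx R) : Prop := IsRKHS {
  rkhs0 : H 0;
  rkhsD : forall f g, H f -> H g -> H (f + g);
  rkhsZ : forall (a : Cplx R) f, H f -> H (a *: f);
  rkhs_ip_linear : forall (a : Cplx R) f g h, H f -> H g -> H h ->
    ip (a *: f + g) h = a * ip f h + ip g h;
  rkhs_ip_conj : forall f g, H f -> H g -> ip g f = (ip f g)^*;
  rkhs_ip_pos : forall f, H f -> f != 0 -> 0 < ip f f;
  rkhs_complete : forall u : nat -> X -> Cplx R,
    (forall n, H (u n)) ->
    (forall e : Cplx R, 0 < e -> exists M : nat, forall m n : nat,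
      (M <= m)%N -> (M <= n)%N -> ip (u m - u n) (u m - u n) < e) ->
    exists2 f, H f & (fun n => ip (u n - f) (u n - f)) @ \oo --> (0 : Cplx R);
  rkhs_kernel : forall y, H (fun x => N x y);
  rkhs_reproducing : forall f y, H f -> ip f (fun x => N x y) = f y
}.

Definition has_dim (H : set (X -> Cplx R)) (n : nat) :=
  exists e : 'I_n -> X -> Cplx R,
    (forall c : 'I_n -> Cplx R, \sum_(i < n) c i *: e i = 0 ->
       forall i, c i = 0) /\
    H = [set \sum_(i < n) c i *: e i | c in [set: 'I_n -> Cplx R]].

(* A kernel has exactly one reproducing kernel Hilbert space, so the
   existential is harmless. *)
Definition has_rank (N : X -> X -> Cplx R) (n : nat) :=
  exists H ip, is_rkhs N H ip /\ has_dim H n.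

End ReproducingKernel.

(* Points are [(lambda, (z1, z2))]. *)
Definition kernel_fun (R : realType) :=
  disc R * bidisc R -> disc R * bidisc R -> Cplx R.

Definition analytic_kernel (R : realType) (N : kernel_fun R) :=
  [/\ psd N,
      forall q, analytic3 (fun l z1 z2 => N (l, (z1, z2)) q)
    & forall p, analytic3 (fun m w1 w2 => (N p (m, (w1, w2)))^*)].

Definition Kker (R : realType) (N1 N2 N3 : kernel_fun R) : kernel_fun R :=
  fun p q =>
    let: (lambda, (z1, z2)) := p in
    let: (mu, (w1, w2)) := q in
    1 - (1 - (val w1)^* * val z1) * N1 p q
      - (1 - (val w2)^* * val z2) * N2 p q
      - (1 - (val mu)^* * val lambda) * N3 p q.

Definition R1tilde (R : realType) :
    set (kernel_fun R * kernel_fun R * kernel_fun R) :=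
  [set N | let: (N1, N2, N3) := N in
    [/\ analytic_kernel N1, analytic_kernel N2, analytic_kernel N3,
        analytic_kernel (Kker N1 N2 N3) & has_rank (Kker N1 N2 N3) 1]].

(* Functions [f (z, lambda)] on the tridisc; note that the order of the
   arguments differs from the one used for kernels. *)
Definition analytic_fun (R : realType) (f : bidisc R * disc R -> Cplx R) :=
  analytic3 (fun z1 z2 l => f ((z1, z2), l)).

Definition Schur3 (R : realType) : set (bidisc R * disc R -> Cplx R) :=
  [set f | analytic_fun f /\ forall x, `|f x| <= 1].

Definition right_factor (R : realType) (K : kernel_fun R)
    (f : bidisc R * disc R -> Cplx R) :=
  forall (lambda mu : disc R) (z w : bidisc R),
    K (lambda, z) (mu, w) = (f (w, mu))^* * f (z, lambda).

Definition RightS (R : realType) (N1 N2 N3 : kernel_fun R) :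
    set (bidisc R * disc R -> Cplx R) :=
  [set f | Schur3 f /\ right_factor (Kker N1 N2 N3) f].

(* Main.v *)
Require Import Defs.
From mathcomp Require Import all_boot all_order all_algebra.
From mathcomp Require Import complex.
From mathcomp Require Import all_classical all_reals all_analysis.
From mathcomp Require Import ring.
Import Order.TTheory GRing.Theory Num.Theory.
Import numFieldNormedType.Exports.
Local Open Scope classical_set_scope.
Local Open Scope ring_scope.

(** A reproducing kernel Hilbert space of dimension one is spanned by a single
    function, and the normalised spanning function [f] satisfies
    [K p q = (f q)^* * f p] ([rank1_factor]). Everything else follows from this
    factorisation of [K = K_(N1, N2, N3)].

    Analyticity of [f]: choosing [q] with [f q != 0], one has
    [f p = K p q / (f q)^*], a multiple of a function that is analytic because
    [K] is an analytic kernel ([factor_analytic]). Contractivity of [f]: on the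
    diagonal [`|f p| ^+ 2 = K p p], and [K p p] is [1] minus three products of
    nonnegative numbers ([Kker_diag_le1]). Uniqueness: two factors of the same
    nonzero kernel differ by a unimodular constant ([factor_unique]), and
    conversely such a constant cancels in [(f q)^* * f p] and changes neither
    analyticity nor the modulus. *)

Section Kernels.
Variables (R : realType) (X : Type).
Implicit Types (N : X -> X -> Cplx R) (f g : X -> Cplx R).

Lemma psd_diag_ge0 N x : psd N -> 0 <= N x x.
Proof.
move=> /(_ 1%N (fun=> x) (fun=> 1)).
by rewrite !big_ord1 rmorph1 !mul1r.
Qed.

(** If [e] spans the space and [s = ip e e], then [N x y = a * e x] for some
    [a], and the reproducing property at [e] reads [(a * s)^* = e y]. Hence
    [N x y = (e y)^* * e x / s], and [f] is [e] divided by its norm. *)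
Lemma rank1_factor N : has_rank N 1 ->
  exists2 f, (exists x, f x != 0) & forall x y, N x y = (f y)^* * f x.
Proof.
case=> H [ip [rk [b [b_free HE]]]]; set e := b ord0.
have e_neq0 : e != 0.
  apply/eqP => e0.
  have sum0 : \sum_(i < 1) 1 *: b i = 0 by rewrite big_ord1 -/e e0 scaler0.
  by have /eqP := b_free (fun=> 1) sum0 ord0; rewrite oner_eq0.
have He : H e by rewrite HE; exists (fun=> 1) => //; rewrite big_ord1 scale1r.
have s_gt0 : 0 < ip e e by exact: rkhs_ip_pos rk _ He e_neq0.
set s := ip e e in s_gt0.
have s_neq0 : s != 0 by rewrite gt_eqF.
have s_conj : s^* = s by apply/CrealP/ger0_real/ltW.
set r := sqrtC s.
have r_conj : r^* = r by apply/CrealP/ger0_real; rewrite sqrtC_ge0 ltW.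
have rr : r * r = s by rewrite -expr2 sqrtCK.
have r_neq0 : r != 0 by rewrite sqrtC_eq0.
have ip_scale a : ip (a *: e) e = a * s.
  (* Linearity is given for [a *: f + g] only, whence the detour. *)
  have := rkhs_ip_linear rk (a - 1) He He He.
  by rewrite scalerBl scale1r subrK => ->; rewrite mulrBl mul1r subrK.
exists (fun x => e x / r).
  apply: contrapT => /forallNP e0; move/eqP: e_neq0; apply; apply/funext => x.
  by have /negP/negPn := e0 x; rewrite mulf_eq0 invr_eq0 (negPf r_neq0) orbF => /eqP.
move=> x y.
have := rkhs_kernel rk y; rewrite {1}HE => -[c _]; rewrite big_ord1 -/e => Ny.
have := rkhs_reproducing rk y He.
rewrite -Ny (rkhs_ip_conj rk (rkhsZ rk _ He) He) ip_scale rmorphM /= s_conj.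
move=> ey.
have -> : N x y = c ord0 * e x by rewrite -[LHS]/((fun x => N x y) x) -Ny.
rewrite -ey !rmorphM fmorphV /= conjCK s_conj r_conj -rr.
by field.
Qed.

(** Evaluating both factorisations at a fixed second argument [x0] with
    [f x0 != 0] gives [g x = (f x0 / g x0)^* * f x], and this constant is
    unimodular because the diagonal gives [`|g| = `|f|]. *)
Lemma factor_unique f g x0 : f x0 != 0 ->
  (forall x y, (g y)^* * g x = (f y)^* * f x) ->
  exists2 eta, `|eta| = 1 & g = (fun x => eta * f x).
Proof.
move=> fx0 fg.
have norm_eq : `|g x0| = `|f x0|.
  have: `|g x0| ^+ 2 = `|f x0| ^+ 2 by rewrite !normCK mulrC fg mulrC.
  by move/eqP; rewrite eqrXn2 // => /eqP.
have gx0 : g x0 != 0 by rewrite -normr_eq0 norm_eq normr_eq0.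
exists ((f x0)^* / (g x0)^* ).
  by rewrite normf_div !norm_conjC norm_eq divff // normr_eq0.
apply/funext => x; apply: (mulfI (_ : (g x0)^* != 0)); first by rewrite conjC_eq0.
by rewrite fg mulrA mulrCA divff ?conjC_eq0 // mulr1.
Qed.

End Kernels.

Section Tridisc.
Variable R : realType.

Lemma analytic3Z (a : Cplx R) (g : disc R -> disc R -> disc R -> Cplx R) :
  analytic3 g -> analytic3 (fun x y z => a * g x y z).
Proof.
case=> G [Gg dG]; exists (a *: G); split=> [x y z|x y z].
  by rewrite -Gg.
exact: differentiableZ.
Qed.

(** Kernels take [(lambda, (z1, z2))] but Schur functions [((z1, z2), lambda)];
    the change of variables is linear, hence differentiable. *)
Lemma analytic3_rot (g : disc R -> disc R -> disc R -> Cplx R) :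
  analytic3 g -> analytic3 (fun y z x => g x y z).
Proof.
case=> G [Gg dG].
pose C : normedModType (Cplx R) := Cplx R.
have dfst (U V : normedModType (Cplx R)) (p : U * V) : differentiable fst p.
  by apply: linear_differentiable => q; exact: cvg_fst.
have dsnd (U V : normedModType (Cplx R)) (p : U * V) : differentiable snd p.
  by apply: linear_differentiable => q; exact: cvg_snd.
exists (fun p => G (p.2.2, (p.1, p.2.1))); split=> [y z x|y z x]; first exact: Gg.
pose rot (p : C * (C * C)) := (p.2.2, (p.1, p.2.1)).
apply: (@differentiable_comp _ _ _ _ rot G); last exact: dG.
apply: differentiable_pair.
  by apply: (@differentiable_comp _ _ _ _ snd snd); [exact: dsnd|exact: dsnd].
apply: differentiable_pair; first exact: dfst.
by apply: (@differentiable_comp _ _ _ _ snd fst); [exact: dsnd|exact: dfst].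
Qed.

(** With [x0 = (z0, l0)], the kernel function of [K] at [(l0, z0)] is
    [(f x0)^* * f], up to the order of the variables. *)
Lemma factor_analytic (K : kernel_fun R) (f : bidisc R * disc R -> Cplx R) x0 :
  analytic_kernel K -> right_factor K f -> f x0 != 0 -> analytic_fun f.
Proof.
case: x0 => z0 l0 [_ anK _] Kf fx0.
have := analytic3Z ((f (z0, l0))^* )^-1 _ (analytic3_rot _ (anK (l0, z0))).
congr (analytic3 _); apply/funext => z1; apply/funext => z2; apply/funext => l.
by rewrite Kf mulKf // conjC_eq0.
Qed.

Lemma disc_weight_ge0 (z : disc R) : 0 <= 1 - (val z)^* * val z.
Proof.
by rewrite mulrC -normCK subr_ge0 expr_le1 // ltW // (valP z).
Qed.

Lemma Kker_diag_le1 (N1 N2 N3 : kernel_fun R) p :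
  psd N1 -> psd N2 -> psd N3 -> Kker N1 N2 N3 p p <= 1.
Proof.
move=> h1 h2 h3.
case: p => l [z1 z2]; rewrite /Kker -!addrA gerDl -!opprD oppr_le0.
by rewrite !addr_ge0 ?mulr_ge0 ?disc_weight_ge0 ?psd_diag_ge0.
Qed.

Lemma right_factor_le1 (N1 N2 N3 : kernel_fun R) f x :
  psd N1 -> psd N2 -> psd N3 -> right_factor (Kker N1 N2 N3) f -> `|f x| <= 1.
Proof.
case: x => z l h1 h2 h3 Kf.
rewrite -(@expr_le1 _ 2) // normCK mulrC -Kf; exact: Kker_diag_le1.
Qed.

End Tridisc.

Theorem proposition4p8 (R : realType) (N1 N2 N3 : kernel_fun R)
    (hN : R1tilde (N1, N2, N3)) :
  [/\ RightS N1 N2 N3 !=set0,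
      RightS N1 N2 N3 `<=` @Schur3 R,
      exists f : bidisc R * disc R -> Cplx R,
        analytic_fun f /\ right_factor (Kker N1 N2 N3) f
    & forall f : bidisc R * disc R -> Cplx R,
        analytic_fun f -> right_factor (Kker N1 N2 N3) f ->
        RightS N1 N2 N3 =
          [set (fun x => eta * f x) | eta in @unit_circle R]].
Proof.
case: hN => -[psd1 _ _] [psd2 _ _] [psd3 _ _] anK rankK.
have schur f : analytic_fun f -> right_factor (Kker N1 N2 N3) f ->
    RightS N1 N2 N3 f.
  by move=> anf Kf; split=> //; split=> // x; exact: right_factor_le1 Kf.
have [h [p0 hp0] Kh] := rank1_factor _ _ _ rankK.
pose f0 (x : bidisc R * disc R) := h (x.2, x.1).
have Kf0 : right_factor (Kker N1 N2 N3) f0 by move=> l m z w; exact: Kh.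
have anf0 : analytic_fun f0.
  apply: (@factor_analytic _ _ _ (p0.2, p0.1) anK Kf0).
  by rewrite /f0 -surjective_pairing.
split; [by exists f0; exact: schur|by move=> f []|by exists f0|].
move=> f anf Kf; apply/seteqP; split=> [g [_ Kg]|g [eta eta1 <-]].
  have fp0 : f (p0.2, p0.1) != 0.
    (* Both squared moduli are the diagonal value of the kernel at [p0]. *)
    apply: contra_neq hp0 => fp0; apply/eqP; rewrite -normr_eq0 -sqrf_eq0.
    case: p0 fp0 => l z /= fp0.
    by rewrite normCK mulrC -Kh Kf fp0 mulr0.
  have [|eta eta1 ->] := @factor_unique _ _ f g _ fp0; last by exists eta.
  by move=> [z l] [w m]; rewrite -Kg -Kf.
apply: schur; first exact: analytic3Z anf.
move=> l m z w; rewrite Kf rmorphM /= mulrACA [_^* * eta]mulrC -normCK.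
by rewrite eta1 expr1n mul1r.
Qed.
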